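(* Let $\mathcal{V}$ be a complete lattice carrying two quantale structures, $\mathcal{V}_\otimes=(\mathcal{V},\otimes,\mathrm{k})$ and $\mathcal{V}_\odot=(\mathcal{V},\odot,e)$. Assume that the unit element $e$ of $\mathcal{V}_\odot$ is approximated from totally below. Then the $\mathcal{V}_\odot$-normed category $\mathcal{V}_\otimes\text{-}\mathbf{Lip}_\odot$ of $\mathcal{V}_\otimes$-categories and arbitrary maps is Cauchy cocomplete.
   Context: A quantale structure on a complete lattice $\mathcal{V}$ is a commutative monoid structure $(\otimes,\mathrm{k})$ such that $\otimes$ preserves arbitrary joins in each variable. For $\mathcal{V}_\odot$, let $[u,-]_\odot$ be the right adjoint of $-\odot u$, i.e. $w\odot u\le v\iff w\le[u,v]_\odot$. For $u,v\in\mathcal{V}$, $u$ is totally below $v$, written $u\lll v$, if for all $S\subseteq\mathcal{V}$, $v\le\bigvee S$ implies $u\le s$ for some $s\in S$. An element $v$ is approximated from totally below if $v=\bigvee\{u\in\mathcal{V}: u\lll v\}$. A $\mathcal{V}_\otimes$-category is a set $X$ with a function $X(-,-):X\times X\to\mathcal{V}$ such that $\mathrm{k}\le X(x,x)$ and $X(y,z)\otimes X(x,y)\le X(x,z)$ for all $x,y,z\in X$. $\mathcal{V}_\otimes\text{-}\mathbf{Lip}_\odot$ has as objects all $\mathcal{V}_\otimes$-categories and as morphisms $X\to Y$ all maps $\varphi:X\to Y$, with norm $|\varphi|=\bigwedge_{x,x'\in X}[X(x,x'),Y(\varphi x,\varphi x')]_\odot$. A $\mathcal{V}_\odot$-normed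 category is an ordinary category with a norm $|f|\in\mathcal{V}$ for every morphism such that $e\le|1_a|$ and $|g|\odot|f|\le|g\cdot f|$. A sequence in a $\mathcal{V}_\odot$-normed category $\mathbb{X}$ is a functor $s=(x_m\xrightarrow{s_{m,n}}x_n)_{m\le n\in\mathbb{N}}$ from the ordered set $\mathbb{N}$ to $\mathbb{X}$. It is Cauchy if $e\le\bigvee_{N}\bigwedge_{N\le m\le n}|s_{m,n}|$. An object $x$ with a cocone $\gamma=(\gamma_n:x_n\to x)_n$ is a normed colimit of $s$ if (C1) $\gamma$ is a colimit cocone in the ordinary category $\mathbb{X}$, and (C2) for all objects $y$ the canonical bijections $\mathrm{Nat}(s_{|N},\Delta y)\to\mathbb{X}(x,y)$, $(f\cdot\gamma_n)_{n\ge N}\mapsto f$ ($N\in\mathbb{N}$), form a colimit cocone in the category of $\mathcal{V}$-normed sets (sets $A$ with a function $|{-}|:A\to\mathcal{V}$; morphisms are maps $f$ with $|a|\le|fa|$), where $s_{|N}$ is the restriction of $s$ to $\{N,N+1,\dots\}$, $\mathrm{Nat}(s_{|N},\Delta y)$ is normed by $|(\sigma_n)_{n\ge N}|=\bigwedge_{n\ge N}|\sigma_n|$, and connecting maps are restrictions. Given (C1), condition (C2) is equivalent to: (C2a) $e\le\bigvee_N\bigwedge_{n\ge N}|\gamma_n|$ and (C2b) $|f|\ge\bigvee_N\bigwedge_{n\ge N}|f\cdot\gamma_n|$ for every morphism $f:x\to y$. $\mathbb{X}$ is Cauchy cocomplete if every Cauchy sequence in $\mathbb{X}$ has a normed colimit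 in $\mathbb{X}$. *)

(* Defs.v *)
From HB Require Import structures.
From mathcomp Require Import all_boot all_order.
From mathcomp Require Import boolp classical_sets.

Set Implicit Arguments.
Unset Strict Implicit.
Unset Printing Implicit Defensive.

Import Order.TTheory.
Local Open Scope classical_set_scope.
Local Open Scope order_scope.

HB.mixin Record Lattice_isComplete d T of Order.Lattice d T := {
  joinS : set T -> T;
  meetS : set T -> T;
  joinSP : forall A : set T, supremums A (joinS A);
  meetSP : forall A : set T, infimums A (meetS A) }.

#[short(type="completeLatticeType")]
HB.structure Definition CompleteLattice d :=
  { T of Order.Lattice d T & Lattice_isComplete d T }.

Section CompleteLatticeTheory.
Context (d : Order.disp_t) (V : completeLatticeType d).
Implicit Types (A : set V) (u v w : V).

Lemma joinS_ub A u : A u -> u <= joinS A.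
Proof. by case: (joinSP A) => ubA _; apply: ubA. Qed.

Lemma joinS_le A v : (forall u, A u -> u <= v) -> joinS A <= v.
Proof. by case: (joinSP A) => _ lbA; apply: lbA. Qed.

Lemma meetS_lb A u : A u -> meetS A <= u.
Proof. by case: (meetSP A) => lbA _; apply: lbA. Qed.

Lemma meetS_ge A v : (forall u, A u -> v <= u) -> v <= meetS A.
Proof. by case: (meetSP A) => _ ubA; apply: ubA. Qed.

Definition totally_below u v :=
  forall S : set V, v <= joinS S -> exists2 s, S s & u <= s.

Definition approximated_from_totally_below v :=
  v = joinS [set u | totally_below u v].

End CompleteLatticeTheory.

Record quantale d (V : completeLatticeType d) := Quantale {
  qunit : V;
  qmul : Monoid.com_law qunit;
  qmul_joinl : forall (A : set V) v,
    qmul (joinS A) v = joinS [set qmul u v | u in A];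
  qmul_joinr : forall u (A : set V),
    qmul u (joinS A) = joinS [set qmul u v | v in A] }.

Section QuantaleTheory.
Context (d : Order.disp_t) (V : completeLatticeType d) (Q : quantale V).
Implicit Types (u v w : V).

Lemma qmul_monol v u u' : u <= u' -> qmul Q u v <= qmul Q u' v.
Proof.
move=> leu; have -> : u' = joinS [set u; u'].
  apply/le_anti/andP; split; first by apply: joinS_ub; right.
  by apply: joinS_le => w [] ->.
by rewrite qmul_joinl; apply: joinS_ub; exists u => //; left.
Qed.

Lemma qmul_monor u v v' : v <= v' -> qmul Q u v <= qmul Q u v'.
Proof. by rewrite !(Monoid.mulmC (qmul Q) u); apply: qmul_monol. Qed.

Definition residual u v : V := joinS [set w | qmul Q w u <= v].

Lemma residualP w u v : (qmul Q w u <= v) = (w <= residual u v).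
Proof.
apply/idP/idP => [le_wu|le_w]; first exact: joinS_ub.
apply: le_trans (qmul_monol u le_w) _.
by rewrite qmul_joinl; apply: joinS_le => _ [w' /= le_w' <-].
Qed.

End QuantaleTheory.

Record category := Category {
  obj :> Type;
  hom : obj -> obj -> Type;
  idm : forall a, hom a a;
  comp : forall a b c, hom b c -> hom a b -> hom a c;
  comp_idl : forall a b (f : hom a b), comp (idm b) f = f;
  comp_idr : forall a b (f : hom a b), comp f (idm a) = f;
  compA : forall a b c e (h : hom c e) (g : hom b c) (f : hom a b),
    comp h (comp g f) = comp (comp h g) f }.

Arguments hom {_} a b.
Arguments idm {_} a.
Arguments comp {_ _ _ _} g f.

Section Sequences.
Local Open Scope nat_scope.
Context (C : category).

Record sequence := Sequence {
  seq_obj :> nat -> C;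
  seq_map : forall m n, m <= n -> hom (seq_obj m) (seq_obj n);
  seq_map_id : forall n, seq_map (leqnn n) = idm (seq_obj n);
  seq_map_comp : forall m n p (le_mn : m <= n) (le_np : n <= p),
    seq_map (leq_trans le_mn le_np) = comp (seq_map le_np) (seq_map le_mn) }.

Record cocone (s : sequence) (x : C) := Cocone {
  leg :> forall n, hom (s n) x;
  leg_comp : forall m n (le_mn : m <= n),
    comp (leg n) (seq_map s le_mn) = leg m }.

Definition is_colimit (s : sequence) (x : C) (gamma : cocone s x) :=
  forall (y : C) (sigma : cocone s y),
    exists! f : hom x y, forall n, comp f (gamma n) = sigma n.

(* [nat_from s N y] is Nat(s_|N, Delta y). *)
Definition nat_from (s : sequence) (N : nat) (y : C) :=
  {sigma : forall n, N <= n -> hom (s n) y |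
    forall m n (le_Nm : N <= m) (le_mn : m <= n),
      comp (sigma n (leq_trans le_Nm le_mn)) (seq_map s le_mn)
      = sigma m le_Nm}.

Lemma nat_from_eq s N y (sigma tau : nat_from s N y) :
  (forall n (le_Nn : N <= n), sval sigma n le_Nn = sval tau n le_Nn) ->
  sigma = tau.
Proof.
case: sigma tau => [sigma ps] [tau pt] /= eq_st; apply: eq_exist.
by apply: functional_extensionality_dep => n; apply: funext => le_Nn.
Qed.

Definition restrict (s : sequence) (M N : nat) (y : C) (le_MN : M <= N)
    (sigma : nat_from s M y) : nat_from s N y.
Proof.
exists (fun n le_Nn => sval sigma n (leq_trans le_MN le_Nn)) => m n le_Nm le_mn.
by rewrite -(svalP sigma m n _ le_mn); congr (comp (sval sigma n _) _).
Defined.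

(* The family (f . gamma_n)_{n >= N}. *)
Definition whisker (s : sequence) (x : C) (gamma : cocone s x) (N : nat) (y : C)
    (f : hom x y) : nat_from s N y.
Proof.
exists (fun n _ => comp f (gamma n)) => m n _ le_mn.
by rewrite -compA leg_comp.
Defined.

End Sequences.

Section NormedSets.
Context (d : Order.disp_t) (V : completeLatticeType d).

Record normed_set := NormedSet {
  nset_sort :> Type;
  nset_norm : nset_sort -> V }.

Definition norm_increasing (A B : normed_set) (f : A -> B) :=
  forall a, nset_norm a <= nset_norm (f a).

Definition nset_hom (A B : normed_set) := {f : A -> B | norm_increasing f}.

Definition nset_id (A : normed_set) : nset_hom A A :=
  exist (@norm_increasing A A) (fun a => a) (fun a => lexx (nset_norm a)).

Definition nset_comp (A B C : normed_set) (g : nset_hom B C)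
    (f : nset_hom A B) : nset_hom A C :=
  exist (@norm_increasing A C) (fun a => sval g (sval f a))
    (fun a => le_trans (svalP f a) (svalP g (sval f a))).

Definition nset_category : category.
Proof.
apply: (@Category normed_set nset_hom nset_id nset_comp).
- by move=> A B [f pf]; apply: eq_exist.
- by move=> A B [f pf]; apply: eq_exist.
- by move=> A B C D h g f; apply: eq_exist.
Defined.

End NormedSets.

Record normed_category d (V : completeLatticeType d) (Q : quantale V) :=
  NormedCategory {
    ncat :> category;
    norm : forall a b : ncat, hom a b -> V;
    norm_idm : forall a : ncat, qunit Q <= norm (idm a);
    norm_comp : forall (a b c : ncat) (g : hom b c) (f : hom a b),
      qmul Q (norm g) (norm f) <= norm (comp g f) }.

Arguments norm {d V Q _ _ _} f.

Section NormedCategories.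
Context (d : Order.disp_t) (V : completeLatticeType d) (Q : quantale V).
Context (X : normed_category Q).

Definition cauchy (s : sequence X) :=
  qunit Q <= joinS (range (fun N : nat =>
    meetS [set v | exists m n (le_mn : (m <= n)%N),
                     (N <= m)%N /\ v = norm (seq_map s le_mn)])).

Definition nat_nset (s : sequence X) (y : X) (N : nat) : normed_set V :=
  NormedSet (fun sigma : nat_from s N y =>
    meetS [set v | exists n (le_Nn : (N <= n)%N), v = norm (sval sigma n le_Nn)]).

Definition hom_nset (x y : X) : normed_set V := NormedSet (@norm d V Q X x y).

Lemma restrict_norm (s : sequence X) (y : X) M N (le_MN : (M <= N)%N)
    (sigma : nat_nset s y M) :
  nset_norm sigma <= nset_norm (restrict le_MN sigma : nat_nset s y N).
Proof.
apply: meetS_ge => _ [n [le_Nn ->]]; apply: meetS_lb.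
by exists n, (leq_trans le_MN le_Nn).
Qed.

Definition nat_nset_map (s : sequence X) (y : X) M N (le_MN : (M <= N)%N) :
    nset_hom (nat_nset s y M) (nat_nset s y N) :=
  exist _ (restrict le_MN : nat_nset s y M -> nat_nset s y N)
    (restrict_norm le_MN).

(* The diagram N |-> Nat(s_|N, Delta y) of restrictions in normed sets. *)
Definition nat_seq (s : sequence X) (y : X) : sequence (nset_category V).
Proof.
refine (@Sequence (nset_category V) (nat_nset s y) (@nat_nset_map s y) _ _).
- move=> N; apply: eq_exist; apply: funext => sigma.
  by apply: nat_from_eq => n le_Nn /=; congr (sval sigma n _).
- move=> M N P le_MN le_NP; apply: eq_exist; apply: funext => sigma.
  by apply: nat_from_eq => n le_Nn /=; congr (sval sigma n _).
Defined.

(* [kappa] consists of the canonical bijections, i.e. of the inverses of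
   f |-> (f . gamma_n)_{n >= N}. *)
Definition canonical (s : sequence X) (x : X) (gamma : cocone s x) (y : X)
    (kappa : @cocone (nset_category V) (nat_seq s y) (hom_nset x y)) :=
  forall N, cancel (sval (kappa N)) (whisker gamma N (y := y)) /\
            cancel (whisker gamma N (y := y)) (sval (kappa N)).

Definition normed_colimit (s : sequence X) (x : X) (gamma : cocone s x) :=
  is_colimit gamma /\
  forall y : X,
    exists2 kappa : @cocone (nset_category V) (nat_seq s y) (hom_nset x y),
      canonical gamma kappa & is_colimit kappa.

Definition cauchy_cocomplete :=
  forall s : sequence X, cauchy s ->
    exists (x : X) (gamma : cocone s x), normed_colimit gamma.

End NormedCategories.

Record vcategory d (V : completeLatticeType d) (Q : quantale V) := VCategory {
  vcat_sort :> Type;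
  vhom : vcat_sort -> vcat_sort -> V;
  vhom_id : forall x, qunit Q <= vhom x x;
  vhom_comp : forall x y z, qmul Q (vhom y z) (vhom x y) <= vhom x z }.

Arguments vhom {d V Q _} x y.

Section Lip.
Context (d : Order.disp_t) (V : completeLatticeType d) (Qt Qo : quantale V).

Definition lip_category : category :=
  @Category (vcategory Qt) (fun X Y => X -> Y) (fun X => id)
    (fun X Y Z g f => g \o f)
    (fun X Y f => erefl) (fun X Y f => erefl)
    (fun X Y Z W h g f => erefl).

Definition lip_norm (X Y : vcategory Qt) (phi : X -> Y) : V :=
  meetS [set v | exists x x' : X,
                   v = residual Qo (vhom x x') (vhom (phi x) (phi x'))].

Definition Lip : normed_category Qo.
Proof.
apply: (@NormedCategory d V Qo lip_category lip_norm).
- move=> X; apply: meetS_ge => _ [x [x' ->]].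
  by rewrite -residualP Monoid.mul1m.
- move=> X Y Z g f; apply: meetS_ge => _ [x [x' ->]].
  rewrite -residualP -Monoid.mulmA.
  have lef : qmul Qo (lip_norm f) (vhom x x') <= vhom (f x) (f x').
    by rewrite residualP; apply: meetS_lb; exists x, x'.
  apply: le_trans (qmul_monor Qo _ lef) _.
  by rewrite residualP; apply: meetS_lb; exists (f x), (f x').
Defined.

End Lip.

(* Main.v *)
Require Import Defs.
From mathcomp Require Import all_boot all_order.
From mathcomp Require Import boolp classical_sets.

(** As arbitrary maps are admitted as morphisms, an ordinary colimit is a
    set-theoretic colimit [X] of the underlying sequence of sets, carrying any
    structure. The structure that makes it a normed colimit is
      [X(x, y) = \/_(N, a, b) /\_(n >= N) X_n(s_{N,n} a, s_{N,n} b)],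
    the join running over all common stages [N] and representatives [a], [b]
    of [x], [y] there. If [u] is totally below [e], the Cauchy condition gives
    an [N] with [u <= |s_{m,n}|] for [N <= m <= n], that is
    [u (.) X_m(a, b) <= X_n(s a, s b)], whence [u <= |gamma_m|] for [m >= N];
    joining over [u] yields (C2a). Condition (C2b) holds because (.) preserves
    the join defining [X(x, y)]. The two tensors are never combined, so they
    need not be compatible. *)

Set Implicit Arguments.
Unset Strict Implicit.
Unset Printing Implicit Defensive.

Import Order.TTheory Defs.
Local Open Scope classical_set_scope.
Local Open Scope order_scope.

(** * Bounding tensors of joins *)

Section QuantaleJoins.
Context (d : Order.disp_t) (V : completeLatticeType d) (Q : quantale V).

Lemma qmul_joinr_le (u : V) (A : set V) (w : V) :
  (forall v, A v -> qmul Q u v <= w) -> qmul Q u (joinS A) <= w.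
Proof. by move=> leA; rewrite qmul_joinr; apply: joinS_le => _ [v /leA le_v <-]. Qed.

Lemma qmul_join_le (A B : set V) (w : V) :
  (forall u v, A u -> B v -> qmul Q u v <= w) ->
  qmul Q (joinS A) (joinS B) <= w.
Proof.
move=> leAB; rewrite qmul_joinl; apply: joinS_le => _ [u Au <-].
by apply: qmul_joinr_le => v; apply: leAB.
Qed.

End QuantaleJoins.

(** * Colimits of sequences of sets *)

Section SetColimit.
Local Open Scope nat_scope.
Context (S : nat -> Type) (t : forall m n, m <= n -> S m -> S n).
Hypothesis t_id : forall n a, t (leqnn n) a = a.
Hypothesis t_comp : forall m n p (le_mn : m <= n) (le_np : n <= p) a,
  t (leq_trans le_mn le_np) a = t le_np (t le_mn a).

(** Since proofs of [m <= p] are unique, paths through different intermediate stages can be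
    compared. *)
Lemma transition_comp m n p (le_mn : m <= n) (le_np : n <= p) (le_mp : m <= p) a :
  t le_np (t le_mn a) = t le_mp a.
Proof. by rewrite -t_comp; congr (t _ _); apply: bool_irrelevance. Qed.

Definition germ_eq (a b : {n & S n}) : Prop :=
  exists p (le_ap : tag a <= p) (le_bp : tag b <= p),
    t le_ap (tagged a) = t le_bp (tagged b).

Lemma germ_eq_sym a b : germ_eq a b -> germ_eq b a.
Proof. by case=> p [le_a [le_b eq_ab]]; exists p, le_b, le_a. Qed.

Lemma germ_eq_trans b a c : germ_eq a b -> germ_eq b c -> germ_eq a c.
Proof.
case=> p [le_ap [le_bp eq_ab]] [q [le_bq [le_cq eq_bc]]].
have le_p := leq_maxl p q; have le_q := leq_maxr p q.
exists (maxn p q), (leq_trans le_ap le_p), (leq_trans le_cq le_q).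
rewrite !t_comp eq_ab -eq_bc !(transition_comp _ _ (leq_trans le_bp le_p)).
by [].
Qed.

(** The quotient of the disjoint union by [germ_eq]; its points are the equivalence classes
    themselves, so extensionality decides their equality. *)
Definition set_colimit : Type :=
  {A : set {n & S n} | exists a, A = germ_eq a}.

Definition germ n (a : S n) : set_colimit :=
  exist _ (germ_eq (existT S n a)) (ex_intro _ (existT S n a) erefl).

Lemma germ_surj (x : set_colimit) : exists n (a : S n), x = germ a.
Proof. by case: x => A [[n a] defA]; exists n, a; apply: eq_exist. Qed.

Lemma germP m n (a : S m) (b : S n) :
  germ a = germ b <->
  exists p (le_mp : m <= p) (le_np : n <= p), t le_mp a = t le_np b.
Proof.
split=> [[eq_ab]|eq_ab].
  (* Evaluating the equality of classes at [b] leaves only reflexivity. *)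
  suff: germ_eq (existT S m a) (existT S n b) by [].
  by rewrite eq_ab; exists n, (leqnn n), (leqnn n).
have {}eq_ab : germ_eq (existT S m a) (existT S n b) := eq_ab.
apply: eq_exist; apply/funext => c; apply/propext; split.
  by apply: germ_eq_trans; apply: germ_eq_sym.
exact: germ_eq_trans.
Qed.

Lemma germ_transition m n (le_mn : m <= n) a : germ (t le_mn a) = germ a.
Proof.
by apply/germP; exists n, (leqnn n), le_mn; rewrite t_id.
Qed.

Lemma set_colimit_universal Y (f : forall n, S n -> Y) :
  (forall m n (le_mn : m <= n) a, f n (t le_mn a) = f m a) ->
  exists! g : set_colimit -> Y, forall n a, g (germ a) = f n a.
Proof.
move=> f_t.
(* The mediating map applies [f] to a chosen representative; compatibility of [f] with the
   transitions makes the choice immaterial. *)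
have rep x : {a : {n & S n} | x = germ (tagged a)}.
  by apply: cid; have [n [a ->]] := germ_surj x; exists (existT S n a).
exists (fun x => f _ (tagged (sval (rep x)))); split=> [n a|g g_f].
  case: (rep _) => -[m b] /= /germP[p [le_np [le_mp eq_ab]]].
  by rewrite -(f_t _ _ le_np) eq_ab f_t.
by apply/funext => x; case: (rep x) => -[m b] /= ->; rewrite g_f.
Qed.

End SetColimit.

(** * Reducing normed colimits to (C2a) and (C2b) *)

Section NormedColimitCriterion.
Context (d : Order.disp_t) (V : completeLatticeType d) (Q : quantale V).
Context (X : normed_category Q) (s : sequence X) (x : X) (gamma : cocone s x).
Hypothesis colim : is_colimit gamma.

(** A cocone is determined by any tail: each leg factors through the one at stage [maxn N n]. *)
Lemma whisker_inj N y : injective (@whisker X s x gamma N y).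
Proof.
move=> f g eq_fg.
have eq_tail n : (N <= n)%N -> comp f (gamma n) = comp g (gamma n).
  by move=> le_Nn; have := congr1 (fun sigma => sval sigma n le_Nn) eq_fg.
have g_cocone m n (le_mn : (m <= n)%N) :
    comp (comp g (gamma n)) (seq_map s le_mn) = comp g (gamma m).
  by rewrite -compA leg_comp.
have [h [_ h_uniq]] := colim (Cocone g_cocone).
rewrite -(h_uniq f) ?(h_uniq g) //= => n.
rewrite -(leg_comp gamma (leq_maxr N n)) !compA.
by rewrite eq_tail // leq_maxl.
Qed.

Lemma whisker_surj N y (sigma : nat_from s N y) :
  exists f, whisker gamma N f = sigma.
Proof.
have seqC m n p (le_mn : (m <= n)%N) (le_np : (n <= p)%N) (le_mp : (m <= p)%N) :
    comp (seq_map s le_np) (seq_map s le_mn) = seq_map s le_mp.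
  by rewrite -seq_map_comp; congr (seq_map s _); apply: bool_irrelevance.
have sigmaC m n (le_Nm : (N <= m)%N) (le_mn : (m <= n)%N) (le_Nn : (N <= n)%N) :
    comp (sval sigma n le_Nn) (seq_map s le_mn) = sval sigma m le_Nm.
  by rewrite -(svalP sigma m n le_Nm le_mn); congr (comp (sval sigma n _) _);
    apply: bool_irrelevance.
(* Legs missing below [N] are obtained by first moving to stage [maxn N n], which is [n] itself once
   [N <= n]. *)
pose tau n := comp (sval sigma _ (leq_maxl N n)) (seq_map s (leq_maxr N n)).
have tau_cocone m n (le_mn : (m <= n)%N) :
    comp (tau n) (seq_map s le_mn) = tau m.
  have le_max : (maxn N m <= maxn N n)%N by rewrite geq_max leq_maxl leq_max le_mn orbT.
  rewrite /tau -(sigmaC _ _ (leq_maxl N m) le_max (leq_maxl N n)) -!compA.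
  by rewrite !(seqC _ _ _ _ _ (leq_trans le_mn (leq_maxr N n))).
have [f [f_tau _]] := colim (Cocone tau_cocone).
exists f; apply: nat_from_eq => n le_Nn /=.
by rewrite f_tau /= /tau (sigmaC _ _ le_Nn).
Qed.

Definition tail_norm N y (f : hom x y) : V :=
  meetS [set v | exists n, (N <= n)%N /\ v = norm (comp f (gamma n))].

Lemma whisker_norm N y (f : hom x y) :
  nset_norm (whisker gamma N f : nat_nset s y N) = tail_norm N f.
Proof.
congr meetS; apply/seteqP; split=> v [n].
  by case=> le_Nn ->; exists n.
by case=> le_Nn ->; exists n, le_Nn.
Qed.

(** (C2b) makes the inverses of whiskering norm increasing, hence a cocone of normed sets; (C2a)
    does the same for the mediating maps out of it. *)
Lemma normed_colimitI :
  qunit Q <= joinS (range (fun N : nat =>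
    meetS [set v | exists n, (N <= n)%N /\ v = norm (gamma n)])) ->
  (forall y (f : hom x y) N, tail_norm N f <= norm f) ->
  normed_colimit gamma.
Proof.
move=> C2a C2b; split=> // y.
pose inv_whisker N sigma := sval (cid (@whisker_surj N y sigma)).
have inv_whiskerK N : cancel (inv_whisker N) (whisker gamma N (y := y)).
  by move=> sigma; apply: svalP (cid (whisker_surj sigma)).
have inv_whisker_norm N :
    norm_increasing (inv_whisker N : nat_nset s y N -> hom_nset x y).
  move=> sigma; rewrite -[in X in X <= _](inv_whiskerK N sigma) whisker_norm.
  exact: C2b.
pose kappa N : @hom (nset_category V) (nat_nset s y N) (hom_nset x y) :=
  exist _ _ (inv_whisker_norm N).
have kappa_cocone M N (le_MN : (M <= N)%N) :
    comp (kappa N) (seq_map (nat_seq s y) le_MN) = kappa M.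
  apply: eq_exist; apply/funext => sigma /=; apply: (@whisker_inj N).
  rewrite inv_whiskerK -[in LHS](inv_whiskerK M sigma).
  exact: nat_from_eq.
exists (Cocone kappa_cocone).
  by move=> N; split=> [|f] /=; [apply: inv_whiskerK
                                |apply: (@whisker_inj N); apply: inv_whiskerK].
move=> A sigma.
(* Restricting a whiskered cocone whiskers by the same [f], so the leg at 0 yields a mediating map
   for every [N]. *)
have sigma_whisker N (f : hom x y) :
    sval (sigma 0%N) (whisker gamma 0 f) = sval (sigma N) (whisker gamma N f).
  rewrite -(leg_comp sigma (leq0n N)) /=; congr (sval (sigma N) _).
  exact: nat_from_eq.
(* [|f| = |f| (.) e <= \/_N |f| (.) /\_n |gamma_n| <= \/_N /\_n |f . gamma_n|]. *)
have ext_norm :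
    norm_increasing (fun f : hom_nset x y => sval (sigma 0%N) (whisker gamma 0 f)).
  move=> f; rewrite -[nset_norm f](Monoid.mulm1 (qmul Q)).
  apply: le_trans (qmul_monor Q _ C2a) _.
  apply: qmul_joinr_le => _ [N _ <-].
  rewrite (sigma_whisker N); apply: le_trans (svalP (sigma N) _).
  rewrite [X in _ <= X](whisker_norm N f).
  apply: meetS_ge => _ [n [le_Nn ->]].
  apply: le_trans (norm_comp f (gamma n)); apply: qmul_monor.
  by apply: meetS_lb; exists n.
exists (exist _ _ ext_norm); split=> [N|[g g_norm] g_sigma].
  case: (sigma N) (sigma_whisker N) => sigmaN sigmaN_norm /= sigmaNE.
  by apply: eq_exist; apply/funext => tau /=; rewrite sigmaNE inv_whiskerK.
apply: eq_exist; apply/funext => f /=.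
rewrite -(g_sigma 0%N) /=; congr g.
by apply: (@whisker_inj 0); rewrite inv_whiskerK.
Qed.

End NormedColimitCriterion.

(** * The colimit of a sequence in [Lip] *)

Section LipColimit.
Context (d : Order.disp_t) (V : completeLatticeType d) (Qt Qo : quantale V).

Lemma lip_normP (X Y : vcategory Qt) (phi : X -> Y) (u : V) :
  (u <= lip_norm Qo phi) <->
  forall a b, qmul Qo u (vhom a b) <= vhom (phi a) (phi b).
Proof.
split=> [le_u a b|le_u].
  by rewrite residualP; apply: le_trans le_u _; apply: meetS_lb; exists a, b.
by apply: meetS_ge => _ [a [b ->]]; rewrite -residualP.
Qed.

Context (s : sequence (Lip Qt Qo)).

(** Together with [lip_map], this retypes the sequence as concrete sets and functions, to which the
    set-level colimit applies. *)
Definition lip_obj (n : nat) : vcategory Qt := s n.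

Definition lip_map (m n : nat) (le_mn : (m <= n)%N) : lip_obj m -> lip_obj n :=
  seq_map s le_mn.

Lemma lip_map_id n a : lip_map (leqnn n) a = a.
Proof. by rewrite /lip_map seq_map_id. Qed.

Lemma lip_map_comp m n p (le_mn : (m <= n)%N) (le_np : (n <= p)%N) a :
  lip_map (leq_trans le_mn le_np) a = lip_map le_np (lip_map le_mn a).
Proof. by rewrite /lip_map seq_map_comp. Qed.

Local Notation colim := (set_colimit lip_map).
Local Notation germ := (germ lip_map).

Definition tail_hom N (a b : lip_obj N) : V :=
  meetS [set v | exists n (le_Nn : (N <= n)%N),
                   v = vhom (lip_map le_Nn a) (lip_map le_Nn b)].

Definition colim_hom (x y : colim) : V :=
  joinS [set v | exists N (a b : lip_obj N),
                   [/\ x = germ a, y = germ b & v = tail_hom a b]].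

Lemma tail_hom_le N a b n (le_Nn : (N <= n)%N) :
  tail_hom a b <= vhom (lip_map le_Nn a) (lip_map le_Nn b).
Proof. by apply: meetS_lb; exists n, le_Nn. Qed.

Lemma tail_hom_le_colim_hom N (a b : lip_obj N) :
  tail_hom a b <= colim_hom (germ a) (germ b).
Proof. by apply: joinS_ub; exists N, a, b. Qed.

Lemma colim_hom_id x : qunit Qt <= colim_hom x x.
Proof.
have [n [a ->]] := germ_surj x.
apply: le_trans (tail_hom_le_colim_hom a a).
by apply: meetS_ge => _ [m [le_nm ->]]; apply: vhom_id.
Qed.

Lemma colim_hom_comp x y z :
  qmul Qt (colim_hom y z) (colim_hom x y) <= colim_hom x z.
Proof.
apply: qmul_join_le => _ _ [M [b [c [-> -> ->]]]] [N [a [b' [-> eq_b ->]]]].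
(* The representatives [b] and [b'] of the middle point merge at stage [p]; from there on,
   composition takes place in each single [lip_obj n]. *)
have [p [le_Mp [le_Np eq_p]]] := (germP lip_map_comp b b').1 eq_b.
rewrite -(germ_transition lip_map_id lip_map_comp le_Np a).
rewrite -(germ_transition lip_map_id lip_map_comp le_Mp c).
apply: le_trans (tail_hom_le_colim_hom _ _).
apply: meetS_ge => _ [n [le_pn ->]].
apply: le_trans (vhom_comp _ (lip_map le_pn (lip_map le_Mp b)) _).
rewrite {2}eq_p -!lip_map_comp.
apply: le_trans (qmul_monol Qt _ (tail_hom_le _ _ (leq_trans le_Mp le_pn))) _.
exact: (qmul_monor Qt _ (tail_hom_le _ _ (leq_trans le_Np le_pn))).
Qed.

Definition lip_colim : vcategory Qt := VCategory colim_hom_id colim_hom_comp.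

Lemma germ_comp m n (le_mn : (m <= n)%N) :
  @comp (Lip Qt Qo) _ _ lip_colim (@germ n) (seq_map s le_mn) = @germ m.
Proof.
by apply/funext => a; apply: (germ_transition lip_map_id lip_map_comp le_mn).
Qed.

Definition germ_cocone : @cocone (Lip Qt Qo) s lip_colim := Cocone germ_comp.

Lemma germ_cocone_colimit : is_colimit germ_cocone.
Proof.
move=> Y sigma; pose f n : lip_obj n -> (Y : vcategory Qt) := sigma n.
have f_map m n (le_mn : (m <= n)%N) a : f n (lip_map le_mn a) = f m a.
  by rewrite /f -(leg_comp sigma le_mn).
have [g [g_f g_uniq]] := set_colimit_universal lip_map_comp f_map.
exists g; split=> [n|h h_sigma]; first by apply/funext => a; apply: g_f.
by apply: g_uniq => n a; rewrite /f -(h_sigma n).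
Qed.

Lemma lip_normed_colimit :
  approximated_from_totally_below (qunit Qo) -> cauchy s ->
  normed_colimit germ_cocone.
Proof.
move=> he s_cauchy; apply: (normed_colimitI germ_cocone_colimit).
  rewrite [X in X <= _]he; apply: joinS_le => u /(_ _ s_cauchy)[_ [N _ <-] le_u].
  apply: le_trans (joinS_ub (ex_intro2 _ _ N I erefl)).
  apply: meetS_ge => _ [m [le_Nm ->]]; apply/lip_normP => a b.
  apply: le_trans (tail_hom_le_colim_hom a b).
  apply: meetS_ge => _ [n [le_mn ->]].
  apply: (lip_normP (lip_map le_mn) u).1.
  by apply: le_trans le_u _; apply: meetS_lb; exists m, n, le_mn.
move=> Y f N; apply/lip_normP => x y.
apply: qmul_joinr_le => _ [M [a [b [-> -> ->]]]].
(* The stage must lie beyond [M], to carry the representatives, and beyond [N], to be counted in the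
   tail norm. *)
have le_M := leq_maxl M N; have le_N := leq_maxr M N.
apply: le_trans (qmul_monor Qo _ (tail_hom_le a b le_M)) _.
rewrite -(germ_transition lip_map_id lip_map_comp le_M a).
rewrite -(germ_transition lip_map_id lip_map_comp le_M b).
apply: (lip_normP (fun c : lip_obj (maxn M N) => f (germ c)) _).1.
by apply: meetS_lb; exists (maxn M N).
Qed.

End LipColimit.

Theorem theorem3p7 (d : Order.disp_t) (V : completeLatticeType d)
    (Qt Qo : quantale V) (he : approximated_from_totally_below (qunit Qo)) :
  cauchy_cocomplete (Lip Qt Qo).
Proof.
move=> s s_cauchy.
by exists (lip_colim s), (germ_cocone s); apply: lip_normed_colimit.
Qed.
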